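(* Let $\alpha,\beta,p,q,k>0$ be real numbers with $kp<1$ and $kq>1$, let $T_c>0$, and let $$\gamma=\frac{\Gamma(m_p)\,\Gamma(m_q)}{\alpha^{k}\,\Gamma(k)\,(q-p)}\left(\frac{\alpha}{\beta}\right)^{m_p},\qquad m_p=\frac{1-kp}{q-p},\quad m_q=\frac{kq-1}{q-p}.$$ Then the origin of the scalar system $$\dot x=-\frac{\gamma}{T_c}\left(\alpha|x|^{p}+\beta|x|^{q}\right)^{k}\operatorname{sign}(x),\qquad x(0)=x_0\in\mathbb{R},$$ is predefined-time stable with strong predefined time $T_c$.
   Context: $\Gamma(z)=\int_0^{+\infty}e^{-t}t^{z-1}\,dt$ is the Gamma function. Consider a system $\dot x=f(x)$, $x(0)=x_0$, with $x\in\mathbb{R}^n$, $f$ continuous and $f(0)=0$; write $x(t,x_0)$ for its solution. Lyapunov stability: the origin is Lyapunov stable if for all $\epsilon>0$ there is $\delta=\delta(\epsilon)>0$ such that for all $\|x_0\|<\delta$, any solution $x(t,x_0)$ exists for all $t\ge 0$ and $\|x(t,x_0)\|<\epsilon$ for all $t\ge 0$. Global finite-time stability: the origin is globally finite-time stable if it is Lyapunov stable and for any $x_0\in\mathbb{R}^n$ there exists $0\le T<+\infty$ such that $x(t,x_0)=0$ for all $t\ge T$. The settling-time function is $T(x_0)=\inf\{T : x(t,x_0)=0\ \forall t\ge T\}$. Fixed-time stability: the origin is fixed-time stable if it is globally finite-time stable and there exists $T_{\max}>0$ with $T(x_0)\le T_{\max}$ for all $x_0\in\mathbb{R}^n$.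 Predefined-time stability: for a constant $T_c>0$ (in general depending on the system parameters), the origin is predefined-time stable with predefined time $T_c$ if it is fixed-time stable and $T(x_0)\le T_c$ for all $x_0\in\mathbb{R}^n$. If moreover $\sup_{x_0\in\mathbb{R}^n}T(x_0)=T_c$, then $T_c$ is called the strong predefined time. *)

(* Defs.v *)
From HB Require Import structures.
From mathcomp Require Import all_boot all_order all_algebra.
From mathcomp Require Import all_classical all_reals all_analysis.

Set Implicit Arguments.
Unset Strict Implicit.
Unset Printing Implicit Defensive.

Import Order.TTheory GRing.Theory Num.Theory.
Import numFieldNormedType.Exports.

Local Open Scope classical_set_scope.
Local Open Scope ring_scope.

(* Euler's Gamma function; the integrand is nonnegative, so the Lebesgue
   integral agrees with the improper one, which is finite for 0 < z. *)
Definition Gamma (R : realType) (z : R) : R :=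
  \int[lebesgue_measure]_(t in `]0, +oo[) (expR (- t) * t `^ (z - 1)).

Section Stability.
Context {R : realType} {V : normedModType R}.

(* The state space is a normed space V over R; R^n is the case V = 'rV[R]_n,
   and a scalar system is the case V = R^o. *)
Implicit Types (f : V -> V) (b : \bar R).

(* [x] solves x' = f(x), x(0) = x0 on the interval [0, b[ (where [b] may be
   +oo).  The limit of the difference quotient is taken inside [0, +oo[, so it
   is the right derivative at t = 0 and the usual derivative at t > 0.  The
   values of [x] outside [0, b[ are irrelevant. *)
Definition is_solution f (x0 : V) b (x : R -> V) : Prop :=
  x 0 = x0 /\
  forall t : R, 0 <= t -> (t%:E < b)%E ->
    h^-1 *: (x (h + t) - x t) @[h --> within [set h | 0 <= h + t] 0^']
      --> f (x t).

(* "Any solution x(t, x0) exists for all t >= 0": there is a global solution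
   from x0, and every solution on some [0, b[ is the restriction of one. *)
Definition solutions_global f (x0 : V) : Prop :=
  (exists x : R -> V, is_solution f x0 +oo%E x) /\
  forall b (x : R -> V), (0 < b)%E -> is_solution f x0 b x ->
    exists2 y : R -> V, is_solution f x0 +oo%E y &
      forall t : R, 0 <= t -> (t%:E < b)%E -> y t = x t.

(* Solutions need not be unique, so properties of x(t, x0) are required of all
   the solutions starting at x0. The first two conjuncts are the standing
   assumptions on the system. *)
Definition lyapunov_stable f : Prop :=
  [/\ continuous f, f 0 = 0 &
    forall eps : R, 0 < eps -> exists2 delta : R, 0 < delta &
      forall x0 : V, `|x0| < delta ->
        solutions_global f x0 /\
        forall x : R -> V, is_solution f x0 +oo%E x ->
          forall t : R, 0 <= t -> `|x t| < eps].

Definition settled_after f (x0 : V) (T : R) : Prop :=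
  0 <= T /\
  forall x : R -> V, is_solution f x0 +oo%E x -> forall t : R, T <= t -> x t = 0.

Definition globally_finite_time_stable f : Prop :=
  lyapunov_stable f /\
  forall x0 : V, solutions_global f x0 /\ exists T : R, settled_after f x0 T.

(* An extended-real infimum, equal to +oo when the solutions never settle. *)
Definition settling_time f (x0 : V) : \bar R :=
  ereal_inf [set T%:E | T in settled_after f x0].

Definition fixed_time_stable f : Prop :=
  globally_finite_time_stable f /\
  exists2 Tmax : R, 0 < Tmax & forall x0 : V, (settling_time f x0 <= Tmax%:E)%E.

Definition predefined_time_stable f (Tc : R) : Prop :=
  [/\ 0 < Tc, fixed_time_stable f &
      forall x0 : V, (settling_time f x0 <= Tc%:E)%E].

Definition strong_predefined_time f (Tc : R) : Prop :=
  predefined_time_stable f Tc /\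
  ereal_sup [set settling_time f x0 | x0 in [set: V]] = Tc%:E.

End Stability.

(* Main.v *)
Require Import Defs.
From HB Require Import structures.
From mathcomp Require Import all_boot all_order all_algebra.
From mathcomp Require Import all_classical all_reals all_analysis.
From mathcomp Require Import measurable_realfun ring.

Import Order.TTheory GRing.Theory Num.Theory.
Import numFieldNormedType.Exports.

Local Open Scope classical_set_scope.
Local Open Scope ring_scope.

(** The right-hand side is [- g(|x|) sign x] with [g] positive and nondecreasing
on the positive reals, so separating variables gives the time needed to reach
the origin from [r > 0] as [tau r = \int_0^r dx / g x]. The bounds [kp < 1 < kq]
make this integral converge at [0] and at infinity respectively, so [tau] is an
increasing bijection from the half-line onto [0, T[ where [T] is the whole
integral. Three facts follow.

- Since the right-hand side is nonincreasing in [x], the squared distance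
  between two solutions is nonincreasing, and solutions are unique forward in
  time ([solution_unique]).
- The inverse [X] of [tau], extended by [0] to the negative reals, is
  differentiable on ]-oo, T[ with [X' = g(X)] ([is_derive_state_at]), so that
  [t |-> sign x0 * X (tau |x0| - t)] is the solution from [x0]. It decreases in
  absolute value and vanishes exactly from time [tau |x0|] on.
- Hence the settling time from [x0] is [tau |x0|], with supremum [T]
  ([feedback_strong_predefined_time]).

It remains to compute [T]. With [w = (beta / alpha) x^(q - p)], the integrand
[dx / g x] becomes a multiple of [w^(mp - 1) (1 + w)^(- (mp + mq)) dw], where
[mp + mq = k]. The integral of this over the half-line is Euler's Beta function
[Gamma mp * Gamma mq / Gamma k] ([beta_integral]), and the constant [gamma] is
the one for which [T = Tc]. The substitution is performed on the primitive, by
the chain rule ([is_derive_time_to_origin]), rather than on the integral. *)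

Set Implicit Arguments.
Unset Strict Implicit.
Unset Printing Implicit Defensive.

(** * Integrals over the open half-line *)

Lemma continuous_itv_oy_measurable (R : realType) (f : R -> R) :
  (forall x : R, 0 < x -> {for x, continuous f}) ->
  measurable_fun (`]0, +oo[ : set R) f.
Proof.
move=> cf; apply: open_continuous_measurable_fun => //.
by move=> x; rewrite inE/= in_itv/= andbT => /cf.
Qed.

(** The integrals of interest are improper at [0] as well as at infinity. By
monotone convergence they are limits of integrals over the closed rays from
[c / (n + 1)], on which the integrand is continuous up to the endpoint. The free
constant [c] lets both sides of a linear substitution be exhausted at once. *)
Lemma integral_oy_exhaustion (R : realType) (f : R -> R) (c : R) : 0 < c ->
  (forall x : R, 0 < x -> {for x, continuous f}) ->
  (forall x : R, 0 < x -> 0 <= f x) ->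
  (\int[lebesgue_measure]_(x in `[(c * n.+1%:R^-1)%R, +oo[) (f x)%:E)%E
    @[n --> \oo] --> (\int[lebesgue_measure]_(x in `]0%R, +oo[) (f x)%:E)%E.
Proof.
move=> c0 cf f0.
have eps0 (n : nat) : 0 < c * n.+1%:R^-1 by rewrite mulr_gt0// invr_gt0 ltr0n.
have sub (n : nat) : `[(c * n.+1%:R^-1)%R, +oo[ `<=` (`]0, +oo[ : set R).
  by move=> x; rewrite /= !in_itv/= !andbT; exact: lt_le_trans.
have -> : (`]0%R, +oo[ = \bigcup_n `[(c * n.+1%:R^-1)%R, +oo[ :> set R)%classic.
  apply/seteqP; split; last by move=> x [n _] /sub.
  have := itvoyEbigcup (0 : R) => E x x0.
  have : (`]0%R, +oo[%classic : set R) (x / c).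
    by move: x0; rewrite /= !in_itv/= !andbT => x0; rewrite divr_gt0.
  rewrite E => -[n _]; rewrite /= in_itv/= andbT add0r => nx.
  by exists n => //=; rewrite in_itv/= andbT mulrC -ler_pdivlMr.
apply: ge0_nondecreasing_set_cvg_integral.
- move=> n m nm; apply/subsetPset => x; rewrite /= !in_itv/= !andbT.
  by apply: le_trans; rewrite ler_pM2l// lef_pV2 ?posrE ?ltr0n// ler_nat.
- by move=> i; exact: measurable_itv.
- move=> i; apply: (measurable_funS _ (@sub i)) => //.
  by apply/measurable_EFinP; exact: continuous_itv_oy_measurable.
- by move=> i x /sub; rewrite /= in_itv/= andbT lee_fin => /f0.
Qed.

Lemma continuous_within_itv_cy (R : realType) (f : R -> R) (a : R) : 0 < a ->
  (forall x : R, 0 < x -> {for x, continuous f}) ->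
  {within `[a, +oo[, continuous f}.
Proof.
move=> a0 cf; apply: continuous_in_subspaceT => x.
by rewrite inE/= in_itv/= andbT => ax; apply: cf; exact: lt_le_trans ax.
Qed.

Lemma integral_oy_scale (R : realType) (f : R -> R) (c : R) : 0 < c ->
  (forall x : R, 0 < x -> {for x, continuous f}) ->
  (forall x : R, 0 < x -> 0 <= f x) ->
  (\int[lebesgue_measure]_(x in `]0%R, +oo[) (f (c * x) * c)%:E =
   \int[lebesgue_measure]_(x in `]0%R, +oo[) (f x)%:E)%E.
Proof.
move=> c0 cf f0.
have dm (x : R) : is_derive x 1 ( *%R c) c.
  by apply: is_derive_eq; rewrite /GRing.scale/= mulr1.
have Em : derive1 ( *%R c : R -> R) = cst c by apply/funext => x; rewrite derive1E derive_val.
have cm (x : R) : {for x, continuous ( *%R c)} by exact: mulrl_continuous.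
have gc x : 0 < x -> {for x, continuous (fun x => f (c * x) * c)}.
  move=> x0; apply: cvgM; last exact: cvg_cst.
  by apply: continuous_comp (cm x) _; apply: cf; rewrite mulr_gt0.
have g0 x : 0 < x -> 0 <= f (c * x) * c.
  by move=> x0; rewrite mulr_ge0 ?f0 ?mulr_gt0// ltW.
have := integral_oy_exhaustion ltr01 gc g0.
have := integral_oy_exhaustion c0 cf f0.
under eq_cvg.
  move=> n; rewrite (@increasing_ge0_integration_by_substitutiony _ ( *%R c)).
  over.
  + by move=> x y _ _; rewrite ltr_pM2l.
  + by rewrite Em => x _; exact: cst_continuous.
  + by rewrite Em; exact: is_cvg_cst.
  + by rewrite Em; exact: is_cvg_cst.
  + by split; [move=> x _; apply: ex_derive | exact/cvg_at_right_filter/cm].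
  + by apply: gt0_cvgMry => //; exact: cvg_id.
  + by apply: continuous_within_itv_cy => //; rewrite mulr_gt0// invr_gt0 ltr0n.
  + move=> x; rewrite in_itv/= andbT => cx; apply: f0; apply: lt_trans cx.
    by rewrite mulr_gt0// invr_gt0 ltr0n.
rewrite Em /=.
under [X in _ -> X -> _]eq_cvg do rewrite mul1r.
by move=> h1 h2; rewrite (cvg_unique _ h1 h2).
Qed.

(** * Euler's Gamma function *)

Lemma is_derive_continuous (R : realType) (f : R -> R) (x l : R) :
  is_derive x 1 f l -> {for x, continuous f}.
Proof.
by move=> df; apply/differentiable_continuous/derivable1_diffP; exact: ex_derive.
Qed.

Lemma powR_continuous (R : realType) (s x : R) : 0 < x ->
  {for x, continuous (fun y : R => y `^ s)}.
Proof.
by move=> x0; apply/differentiable_continuous/derivable1_diffP/derivable_powR;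
   rewrite in_itv/= x0.
Qed.

(** Comparison test on the open half-line: on each closed ray the integral of the
majorant [d] is [l - F e], which is at most [l]. *)
Lemma integral_oy_le_primitive (R : realType) (f d F : R -> R) (l : R) :
  (forall x : R, 0 < x -> {for x, continuous f}) ->
  (forall x : R, 0 < x -> {for x, continuous d}) ->
  (forall x : R, 0 < x -> 0 <= f x <= d x) ->
  (forall x : R, 0 < x -> is_derive x 1 F (d x)) ->
  (forall x : R, 0 < x -> 0 <= F x) ->
  F x @[x --> +oo] --> l ->
  (\int[lebesgue_measure]_(x in `]0%R, +oo[) (f x)%:E <= l%:E)%E.
Proof.
move=> cf cd fd dF F0 Fl.
have f0 x : 0 < x -> 0 <= f x by move=> /fd/andP[].
have cvgf := integral_oy_exhaustion ltr01 cf f0.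
rewrite -(cvg_lim _ cvgf)//; apply: lime_le; first by apply/cvg_ex; eexists; exact: cvgf.
near=> n; set e := 1 * _; have e0 : 0 < e by rewrite mulr_gt0// invr_gt0 ltr0n.
have ex_gt0 x : e <= x -> 0 < x by exact: lt_le_trans.
apply: (@le_trans _ _ (\int[lebesgue_measure]_(x in `[e, +oo[) (d x)%:E)%E).
  have sub : `[e, +oo[ `<=` (`]0, +oo[ : set R).
    by move=> x; rewrite /= !in_itv/= !andbT => /ex_gt0.
  apply: ge0_le_integral => //.
  - by move=> x; rewrite /= in_itv/= andbT lee_fin => /ex_gt0/f0.
  - apply: (measurable_funS _ sub) => //.
    by apply/measurable_EFinP; exact: continuous_itv_oy_measurable.
  - apply: (measurable_funS _ sub) => //.
    by apply/measurable_EFinP; exact: continuous_itv_oy_measurable.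
  - by move=> x; rewrite /= in_itv/= andbT lee_fin => /ex_gt0/fd/andP[].
rewrite (@ge0_continuous_FTC2y _ d F e l)//.
- by rewrite -EFinB lee_fin gerBl F0.
- by move=> x /ex_gt0 /fd /andP[]; exact: le_trans.
- exact: continuous_within_itv_cy.
- by move=> x /ltW/ex_gt0/dF dFx; exact: ex_derive.
- apply/cvg_at_right_filter.
  exact: is_derive_continuous (dF _ e0).
- move=> x; rewrite in_itv/= andbT => /ltW/ex_gt0/dF dFx.
  by rewrite derive1E derive_val.
Unshelve. all: by end_near. Qed.

(** This is [1 + u <= expR u] at [u = x / y - 1], raised to the power [y]. *)
Lemma powR_le_expR (R : realType) (y x : R) : 0 < y -> 0 <= x ->
  x `^ y <= y `^ y * expR (x - y).
Proof.
move=> y0 x0.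
have -> : x - y = (x / y - 1) * y by field; rewrite gt_eqF.
rewrite expRM -powRM ?expR_ge0 ?(ltW y0)//.
apply: ge0_ler_powR; rewrite ?nnegrE ?(ltW y0) ?mulr_ge0 ?expR_ge0 ?(ltW y0)//.
rewrite mulrC -ler_pdivrMr//.
by have := expR_ge1Dx (x / y - 1); rewrite addrC subrK.
Qed.

Definition gamma_integrand (R : realType) (z t : R) : R :=
  expR (- t) * t `^ (z - 1).

Lemma gamma_integrand_continuous (R : realType) (z x : R) : 0 < x ->
  {for x, continuous (@gamma_integrand R z)}.
Proof.
move=> x0; apply: cvgM; last exact: powR_continuous.
apply: continuous_comp; first exact: opp_continuous.
exact: continuous_expR.
Qed.

Lemma gamma_integrand_ge0 (R : realType) (z t : R) : 0 <= gamma_integrand z t.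
Proof. by rewrite mulr_ge0 ?expR_ge0 ?powR_ge0. Qed.

(** One majorant controls both ends: up to a constant [C], the integrand is below
[u ^ (z - 1) * u'] with [u = t / (1 + t)], whose primitive [u ^ z / z] is bounded.
The comparison amounts to [(1 + t) ^ (z + 1) <= C * expR t]. *)
Lemma Gamma_integral_lty (R : realType) (z : R) : 0 < z ->
  (\int[lebesgue_measure]_(t in `]0%R, +oo[) (gamma_integrand z t)%:E < +oo)%E.
Proof.
move=> z0.
pose C := (z + 1) `^ (z + 1) * expR (1 - (z + 1)).
have C0 : 0 <= C by rewrite mulr_ge0 ?powR_ge0 ?expR_ge0.
pose u (t : R) := t / (1 + t).
pose d (t : R) := C * (u t `^ (z - 1) * (1 + t) ^- 2).
pose F (t : R) := C * (z^-1 * u t `^ z).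
have t1 (t : R) : 0 < t -> 0 < 1 + t by move=> t0; rewrite addr_gt0.
have u0 (t : R) : 0 < t -> 0 < u t by move=> t0; rewrite divr_gt0// t1.
have du (t : R) : 0 < t -> is_derive t 1 u ((1 + t) ^- 2).
  move=> t0; have t10 : 1 + t != 0 by rewrite gt_eqF ?t1.
  have d1 : is_derive t 1 (fun t : R => 1 + t) 1.
    by apply: is_derive_eq; rewrite add0r mulr1.
  have dV := is_deriveV t10 d1.
  have -> : u = id * (fun y => (1 + y)^-1) by [].
  by apply: is_derive_eq; rewrite /GRing.scale/=; field.
apply: (@le_lt_trans _ _ (C * (z^-1 * 1))%:E); last exact: ltry.
apply: (@integral_oy_le_primitive _ _ d F).
- exact: gamma_integrand_continuous.
- move=> t t0; apply: cvgM; first exact: cvg_cst.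
  apply: cvgM.
    apply: (@continuous_comp _ _ _ u (fun y => y `^ (z - 1))).
      exact: is_derive_continuous (du _ t0).
    exact/powR_continuous/u0.
  apply: cvgV; first by rewrite expf_neq0// gt_eqF ?t1.
  by apply: cvgM; apply: cvgD; exact: cvg_cst || exact: cvg_id.
- move=> t t0; rewrite gamma_integrand_ge0/= /d /gamma_integrand /u.
  rewrite powRM ?invr_ge0 ?(ltW t0) ?(ltW (t1 _ t0))//.
  rewrite [leRHS](_ : _ =
      t `^ (z - 1) * (C * ((1 + t)^-1 `^ (z - 1) * (1 + t) ^- 2))); last by ring.
  rewrite mulrC ler_wpM2l ?powR_ge0//.
  have -> : (1 + t)^-1 `^ (z - 1) * (1 + t) ^- 2 = ((1 + t) `^ (z + 1))^-1.
    rewrite -powR_inv1 ?(ltW (t1 _ t0))// -powRrM mulN1r powRN.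
    rewrite -powR_mulrn ?(ltW (t1 _ t0))// -invfM -powRD.
      by congr ((_ `^ _)^-1); ring.
    by rewrite (gt_eqF (t1 _ t0)) implybT.
  rewrite expRN ler_pdivlMr ?powR_gt0 ?t1// mulrC ler_pdivrMr ?expR_gt0//.
  rewrite /C -mulrA -expRD.
  have -> : 1 - (z + 1) + t = 1 + t - (z + 1) by ring.
  by apply: powR_le_expR; [rewrite addr_gt0|exact/ltW/t1].
- move=> t t0.
  have dp := @is_derive1_powR _ z _ (u0 _ t0).
  have dc := is_derive1_comp dp (du _ t0).
  have -> : F = C *: (z^-1 *: ((fun y => y `^ z) \o u)) by [].
  by apply: is_derive_eq; rewrite /d /GRing.scale/=; field; rewrite !gt_eqF// t1.
- by move=> t t0; rewrite !mulr_ge0 ?invr_ge0 ?(ltW z0) ?powR_ge0.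
- apply: cvgM; first exact: cvg_cst.
  apply: cvgM; first exact: cvg_cst.
  have u1 : u t @[t --> +oo] --> (1 : R).
    apply/cvgrPdist_le => e e0; near=> t.
    have t0 : 0 < t by near: t; exact: nbhs_pinfty_gt.
    have -> : 1 - u t = (1 + t)^-1 by rewrite /u; field; rewrite gt_eqF ?t1.
    rewrite gtr0_norm ?invr_gt0 ?t1// invf_ple ?posrE ?t1//.
    by apply: ler_wpDl => //; near: t; apply: nbhs_pinfty_ge; exact: num_real.
  have := cvg_comp _ _ u1 (powR_continuous (s := z) ltr01).
  by rewrite /= powR1.
Unshelve. all: by end_near. Qed.

Lemma GammaE (R : realType) (z : R) : 0 < z ->
  (\int[lebesgue_measure]_(t in `]0%R, +oo[) (gamma_integrand z t)%:E =
   (Gamma z)%:E)%E.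
Proof.
move=> z0; rewrite /Gamma /Rintegral fineK//.
rewrite ge0_fin_numE ?Gamma_integral_lty//.
by apply: integral_ge0 => t _; rewrite lee_fin gamma_integrand_ge0.
Qed.

(** On [1, 2] the integrand is at least [expR (- 2) / 2], because
[t ^ (z - 1) >= t ^ (- 1) >= 1 / 2] there. *)
Lemma Gamma_gt0 (R : realType) (z : R) : 0 < z -> 0 < Gamma z.
Proof.
move=> z0; rewrite -lte_fin -GammaE//.
have sub : `[1, 2] `<=` (`]0, +oo[ : set R).
  by move=> x; rewrite /= !in_itv/= andbT => /andP[+ _]; exact: lt_le_trans.
have mg : measurable_fun (`]0, +oo[ : set R) (EFin \o @gamma_integrand R z).
  apply/measurable_EFinP; apply: continuous_itv_oy_measurable.
  exact: gamma_integrand_continuous.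
apply: (@lt_le_trans _ _ (\int[lebesgue_measure]_(t in `[1%R, 2%R]) (expR (- 2) / 2)%:E)%E).
  rewrite integral_cst//= lebesgue_measure_itv/= lte_fin ltr1n.
  by rewrite -EFinB -EFinM lte_fin !mulr_gt0 ?expR_gt0// subr_gt0 ltr1n.
apply: (@le_trans _ _ (\int[lebesgue_measure]_(t in `[1%R, 2%R]) (gamma_integrand z t)%:E)%E); last first.
  by apply: ge0_subset_integral => // t _; rewrite lee_fin gamma_integrand_ge0.
apply: ge0_le_integral => //=.
- exact: (measurable_funS _ sub).
- move=> t; rewrite in_itv/= => /andP[t1 t2]; rewrite lee_fin.
  rewrite ler_pM ?expR_ge0// ?ler_expR ?lerN2//.
  apply: (@le_trans _ _ (t `^ (- 1))).
    by rewrite powR_inv1 ?lef_pV2 ?posrE// ?(le_trans _ t1)// (lt_le_trans _ t1).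
  by apply: ler_powR => //; rewrite lerBrDr addNr ltW.
Qed.

Lemma Gamma_scale (R : realType) (z c : R) : 0 < z -> 0 < c ->
  (\int[lebesgue_measure]_(t in `]0%R, +oo[) (expR (- (c * t)) * t `^ (z - 1))%:E =
   (Gamma z * c `^ (- z))%:E)%E.
Proof.
move=> z0 c0.
have cg := @gamma_integrand_continuous R z.
have gc x : 0 < x -> {for x, continuous (fun t : R => expR (- (c * t)) * t `^ (z - 1))}.
  move=> x0; apply: cvgM; last exact: powR_continuous.
  apply: (@continuous_comp _ _ _ (fun t => - (c * t))); last exact: continuous_expR.
  by apply: cvgN; exact: mulrl_continuous.
rewrite EFinM -GammaE// -(integral_oy_scale c0)//; last first.
  by move=> *; exact: gamma_integrand_ge0.
rewrite muleC -ge0_integralZl_EFin ?powR_ge0//=.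
- apply: eq_integral => t; rewrite inE/= in_itv/= andbT => t0.
  rewrite -EFinM /gamma_integrand powRM ?(ltW c0) ?(ltW t0)//; congr EFin.
  rewrite [RHS](_ : _ = expR (- (c * t)) * t `^ (z - 1) *
     (c `^ (- z) * (c * c `^ (z - 1)))); last by ring.
  by rewrite mulr_powRB1 ?(ltW c0)// -powRD ?(gt_eqF c0) ?implybT// addNr powRr0 mulr1.
- by move=> t _; rewrite lee_fin mulr_ge0 ?gamma_integrand_ge0// ltW.
- apply/measurable_EFinP; apply: continuous_itv_oy_measurable => x x0.
  apply: cvgM; last exact: cvg_cst.
  apply: (continuous_comp (mulrl_continuous (x := c) (x0 := x))).
  by apply: cg; rewrite mulr_gt0.
Qed.

(** * Euler's Beta integral *)

Lemma integral_indicE (R : realType) (D : set R) (f : R -> R) :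
  (\int[lebesgue_measure]_(x in D) (f x)%:E =
   \int[lebesgue_measure]_x (\1_D x * f x)%:E)%E.
Proof.
rewrite integral_mkcond; apply: eq_integral => x _.
by rewrite patchE indicE; case: (x \in D); rewrite ?mul1r ?mul0r.
Qed.

(** By Tonelli's theorem applied to
[v ^ (a + b - 1) * w ^ (a - 1) * expR (- v (1 + w))] on the open quadrant:
integrating first in [w] gives [Gamma a] times the integrand of [Gamma b], and
integrating first in [v] gives [Gamma (a + b)] times the integrand below. Each
inner integral is an instance of [Gamma_scale]. *)
Lemma beta_integral (R : realType) (a b : R) : 0 < a -> 0 < b ->
  (\int[lebesgue_measure]_(w in `]0%R, +oo[)
     (w `^ (a - 1) * (1 + w) `^ (- (a + b)))%:E =
   (Gamma a * Gamma b / Gamma (a + b))%:E)%E.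
Proof.
move=> a0 b0; have ab0 : 0 < a + b by exact: addr_gt0.
pose D : set R := `]0, +oo[%classic.
have D0 x : x \in D -> 0 < x by rewrite inE /D/= in_itv/= andbT.
have mD : measurable D by exact: measurable_itv.
(* The indicators make both orders of integration range over the whole line. *)
pose F (z : R * R) := (\1_D z.1 * \1_D z.2 *
  (z.1 `^ (a + b - 1) * z.2 `^ (a - 1) * expR (- (z.1 * (1 + z.2)))))%:E.
have mF : measurable_fun [set: measurableTypeR R * measurableTypeR R] F.
  have mp s : measurable_fun setT (fun x : R => x `^ s) by exact: measurable_powR.
  have m1 : measurable_fun setT (\1_D : R -> R) by exact: measurable_indic.
  have mf := @measurable_fst _ _ (measurableTypeR R) (measurableTypeR R).
  have ms := @measurable_snd _ _ (measurableTypeR R) (measurableTypeR R).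
  apply/measurable_EFinP; apply: measurable_funM; apply: measurable_funM.
  - exact: (measurableT_comp m1 mf).
  - exact: (measurableT_comp m1 ms).
  - by apply: measurable_funM; [exact: (measurableT_comp (mp _) mf) |
      exact: (measurableT_comp (mp _) ms)].
  - apply: (measurableT_comp (@measurable_expR R)).
    apply: measurableT_comp => //; apply: measurable_funM => //.
    by apply: measurable_funD.
have F0 z : (0 <= F z)%E.
  by rewrite lee_fin !mulr_ge0 ?powR_ge0 ?expR_ge0// indicE.
have := @fubini_tonelli _ _ _ _ _ lebesgue_measure lebesgue_measure F mF F0.
have -> : (\int[lebesgue_measure]_v \int[lebesgue_measure]_w F (v, w) =
           (Gamma a * Gamma b)%:E)%E.
  transitivity (\int[lebesgue_measure]_v (\1_D v * (Gamma a * gamma_integrand b v))%:E)%E.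
    apply: eq_integral => v _; rewrite /F/= indicE.
    have [/D0 v0|_] := boolP (v \in D); last first.
      rewrite !mul0r; under eq_integral do rewrite !mul0r.
      by rewrite integral0.
    rewrite mul1r.
    transitivity ((v `^ (a + b - 1) * expR (- v))%:E *
       \int[lebesgue_measure]_(w in D) (expR (- (v * w)) * w `^ (a - 1))%:E)%E.
      rewrite (integral_indicE D) -ge0_integralZl_EFin ?mulr_ge0 ?powR_ge0 ?expR_ge0//.
      - apply: eq_integral => w _; rewrite -EFinM; congr EFin.
        by rewrite mulr1n mulrDr mulr1 opprD expRD; ring.
      - by move=> w _; rewrite lee_fin !mulr_ge0 ?powR_ge0 ?expR_ge0// indicE.
      - apply/measurable_EFinP; apply: measurable_funM => //.
        apply: measurable_funM => //; apply: measurableT_comp => //.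
        by apply: measurableT_comp => //; exact: measurable_funM.
    rewrite Gamma_scale// -EFinM; congr EFin.
    rewrite [LHS](_ : _ = Gamma a * (expR (- v) * (v `^ (a + b - 1) * v `^ (- a)))); last by ring.
    rewrite -powRD ?(gt_eqF v0) ?implybT//.
    by have -> : a + b - 1 - a = b - 1 by ring.
  rewrite -(integral_indicE D); under eq_integral do rewrite EFinM.
  rewrite ge0_integralZl_EFin ?GammaE// ?(ltW (Gamma_gt0 a0))//.
  - by move=> v _; rewrite lee_fin gamma_integrand_ge0.
  - apply/measurable_EFinP; apply: continuous_itv_oy_measurable.
    exact: gamma_integrand_continuous.
have -> : (\int[lebesgue_measure]_w \int[lebesgue_measure]_v F (v, w) =
    (Gamma (a + b))%:E * \int[lebesgue_measure]_(w in `]0%R, +oo[)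
     (w `^ (a - 1) * (1 + w) `^ (- (a + b)))%:E)%E.
  rewrite -ge0_integralZl_EFin ?(ltW (Gamma_gt0 _))//; last 2 first.
    by move=> w _; rewrite lee_fin mulr_ge0 ?powR_ge0.
    apply/measurable_EFinP; apply: measurable_funTS; apply: measurable_funM => //.
    by apply: (measurableT_comp (measurable_powR _)); exact: measurable_funD.
  under [RHS]eq_integral do rewrite -EFinM.
  rewrite (integral_indicE D).
  apply: eq_integral => w _; rewrite /F/= -/D [in RHS]indicE.
  have [/[dup] wD /D0 w0|wD] := boolP (w \in D); last first.
    rewrite !mul0r; under eq_integral do rewrite [\1_D w]indicE (negbTE wD) mulr0 mul0r.
    by rewrite integral0.
  rewrite mul1r.
  transitivity ((w `^ (a - 1))%:E *
       \int[lebesgue_measure]_(v in D) (expR (- ((1 + w) * v)) * v `^ (a + b - 1))%:E)%E.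
    rewrite (integral_indicE D) -ge0_integralZl_EFin ?powR_ge0//.
    - apply: eq_integral => v _; rewrite -EFinM [\1_D w]indicE wD; congr EFin.
      by rewrite mulr1n (mulrC v); ring.
    - by move=> v _; rewrite lee_fin !mulr_ge0 ?powR_ge0 ?expR_ge0// indicE.
    - apply/measurable_EFinP; apply: measurable_funM => //.
      apply: measurable_funM => //; apply: measurableT_comp => //.
      by apply: measurableT_comp => //; exact: measurable_funM.
  by rewrite Gamma_scale ?addr_gt0// -EFinM; congr EFin; ring.
move=> E; rewrite EFinM E muleAC -EFinM mulfV ?mul1e//.
by rewrite gt_eqF// Gamma_gt0.
Qed.

Definition beta_integrand (R : realType) (a b w : R) : R :=
  w `^ (a - 1) * (1 + w) `^ (- (a + b)).

Definition incomplete_beta (R : realType) (a b w : R) : R :=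
  \int[lebesgue_measure]_(v in `[0, w]) beta_integrand a b v.

Section incomplete_beta.
Context {R : realType}.
Variables (a b : R).
Hypotheses (a0 : 0 < a) (b0 : 0 < b).
Local Notation h := (beta_integrand a b).
Local Notation B := (incomplete_beta a b).

Let h_ge0 (w : R) : 0 <= h w. Proof. by rewrite mulr_ge0 ?powR_ge0. Qed.

Let h_continuous (w : R) : 0 < w -> {for w, continuous h}.
Proof.
move=> w0; apply: cvgM; first exact: powR_continuous.
have c1 : {for w, continuous (fun x : R => 1 + x)}.
  by apply: cvgD; [exact: cvg_cst|exact: cvg_id].
have w1 : 0 < 1 + w by rewrite addr_gt0.
exact: continuous_comp c1 (powR_continuous (s := - (a + b)) w1).
Qed.

Let mh : measurable_fun [set: R] h.
Proof.
apply: measurable_funM; first exact: measurable_powR.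
by apply: (measurableT_comp (measurable_powR _)); exact: measurable_funD.
Qed.

Let integral_h : (\int[lebesgue_measure]_(w in `[0%R, +oo[) (h w)%:E =
   (Gamma a * Gamma b / Gamma (a + b))%:E)%E.
Proof.
rewrite -beta_integral// integral_itv_obnd_cbnd//.
by apply/measurable_EFinP; exact: measurable_funTS.
Qed.

Let integrable_h u : lebesgue_measure.-integrable `[0, u] (EFin \o h).
Proof.
apply: (@integrableS _ _ _ lebesgue_measure `[0, +oo[) => //.
  by apply: subset_itvl.
apply/integrableP; split; first by apply/measurable_EFinP; exact: measurable_funTS.
under eq_integral do rewrite /= ger0_norm ?h_ge0//.
by rewrite integral_h ltry.
Qed.

Lemma incomplete_beta0 : B 0 = 0.
Proof. by rewrite /incomplete_beta set_itv1 Rintegral_set1. Qed.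

Lemma cvg_incomplete_beta0 : B w @[w --> 0^'+] --> 0.
Proof.
by apply/cvg_at_right_filter/(parameterized_integral_cvg_left ltr01)/integrable_h.
Qed.

Lemma is_derive_incomplete_beta (w : R) : 0 < w -> is_derive w 1 B (h w).
Proof.
move=> w0.
have w1 : w < w + 1 by rewrite ltrDl.
have [dB <-] := continuous_FTC1_closed w1 (integrable_h (w + 1)) w0 (h_continuous w0).
by rewrite derive1E; apply: DeriveDef.
Qed.

(** [incomplete_beta] is nondecreasing and bounded, so it has a limit, which is
identified along the integers by monotone convergence. *)
Lemma cvg_incomplete_beta :
  B w @[w --> +oo] --> Gamma a * Gamma b / Gamma (a + b).
Proof.
have mhE D : measurable_fun (D : set R) (fun x => (h x)%:E).
  by apply/measurable_EFinP; exact: measurable_funTS.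
have BE x : (B x)%:E = (\int[lebesgue_measure]_(w in `[0%R, x]) (h w)%:E)%E.
  by rewrite /incomplete_beta /Rintegral fineK//; exact: integrable_fin_num.
have leB x y : x <= y -> B x <= B y.
  move=> xy; rewrite -lee_fin !BE; apply: ge0_subset_integral => //.
  - exact: mhE.
  - by move=> w _; rewrite lee_fin.
  - exact: subset_itvl.
have BL x : B x <= Gamma a * Gamma b / Gamma (a + b).
  rewrite -lee_fin BE -integral_h; apply: ge0_subset_integral => //.
  - exact: mhE.
  - by move=> w _; rewrite lee_fin.
  - exact: subset_itvl.
have supB : has_ubound (range B) by eexists => _ [x _ <-]; exact: BL.
have cB := nondecreasing_cvgr leB supB.
suff -> : Gamma a * Gamma b / Gamma (a + b) = sup (range B) by [].
have sn : (n.+1%:R : R) @[n --> \oo] --> +oo.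
  by have := @cvgr_idn R; rewrite -cvg_shiftS.
have cBn := cvg_comp _ _ sn cB.
apply: cvg_unique cBn => //.
apply: fine_cvg; rewrite -integral_h itv0y_bigcup0S.
apply: ge0_nondecreasing_set_cvg_integral => //.
- move=> n m nm; apply/subsetPset; apply: subset_itvl.
  by rewrite bnd_simp ler_nat.
- by move=> n; exact: mhE.
- by move=> n x _; rewrite lee_fin.
Qed.

End incomplete_beta.

(** * Uniqueness of solutions for nonincreasing right-hand sides *)

Lemma is_derive_cvg (R : realType) (x : R -> R) (t l : R) :
  is_derive t 1 x l <-> h^-1 *: (x (h + t) - x t) @[h --> 0^'] --> l.
Proof.
have -> : (fun h : R => h^-1 *: (x (h + t) - x t)) =
          (fun h : R => h^-1 *: (x (h *: 1 + t) - x t)).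
  by apply/funext => h; rewrite [h *: 1]mulr1.
split=> [[dx <-]|cx]; first exact: dx.
apply: DeriveDef; first by apply/cvg_ex; exists l.
exact: cvg_lim cx.
Qed.

(** At [t > 0] the constraint [0 <= h + t] holds for all small [h], so the
one-sided difference quotient of [is_solution] is the ordinary one. *)
Lemma solution_is_derive (R : realType) (f : R^o -> R^o) (x0 : R) (b : \bar R)
    (x : R -> R) (t : R) :
  is_solution f x0 b x -> 0 < t -> (t%:E < b)%E -> is_derive t 1 x (f (x t)).
Proof.
move=> [_ sx] t0 tb; apply/is_derive_cvg.
apply: cvg_trans (sx t (ltW t0) tb); apply: cvg_app => A wA.
have nt : \forall h \near 0^', 0 <= h + t.
  near=> h; rewrite -lerBlDr sub0r lerNl.
  rewrite (le_trans (ler_norm _))// normrN.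
  by near: h; exact: dnbhs0_le.
by move: nt wA; apply: filterS2 => h ht /(_ ht).
Unshelve. all: by end_near. Qed.

(** Right continuity at [0], from [x h = x 0 + h * ((x h - x 0) / h)]. *)
Lemma solution_cvg0 (R : realType) (f : R^o -> R^o) (x0 : R) (b : \bar R)
    (x : R -> R) :
  is_solution f x0 b x -> (0 < b)%E -> x h @[h --> 0^'+] --> x 0.
Proof.
move=> [_ sx] b0.
have cq : h^-1 * (x h - x 0) @[h --> 0^'+] --> f (x 0).
  have := sx 0 (lexx _) b0; under eq_cvg do rewrite addr0.
  apply: cvg_trans; apply: cvg_app => A.
  (* At [t = 0] the domain of the quotient is the right half of [0^'], up to the
     encodings of the two filters. *)
  change ((\forall h \near 0, h != 0 -> 0 <= h + 0 -> A h) ->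
    \forall h \near 0, 0 < h -> A h).
  apply: filterS => h Ah h0; apply: Ah; first by rewrite gt_eqF.
  by rewrite addr0 ltW.
have cid : (h : R) @[h --> 0^'+] --> (0 : R) by exact/cvg_at_right_filter/cvg_id.
have := cvgD (cvgM cid cq) (cvg_cst (x 0)); rewrite mul0r add0r.
have F0 : Filter (0 : R)^'+ by exact: at_right_proper_filter.
move=> /(_ F0 F0 F0) cx.
apply: cvg_trans cx; apply: near_eq_cvg; near=> h.
by rewrite -[LHS]/(h * (h^-1 * (x h - x 0)) + x 0) mulrA mulfV ?mul1r ?subrK.
Unshelve. all: by end_near. Qed.

(** If [f] is nonincreasing then [(x - y)^2] has derivative
[2 (x - y) (f x - f y) <= 0] and vanishes at time [0]. *)
Lemma solution_unique (R : realType) (f : R^o -> R^o) (x0 : R) (b : \bar R)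
    (x y : R -> R) :
  {homo f : u v /~ u <= v} ->
  is_solution f x0 b x -> is_solution f x0 b y ->
  forall t : R, 0 <= t -> (t%:E < b)%E -> x t = y t.
Proof.
move=> fdecr sx sy t t0 tb.
have [xi yi] : x 0 = x0 /\ y 0 = x0 by case: sx sy => + _ [+ _].
move: t0; rewrite le_eqVlt => /predU1P[<-|t0]; first by rewrite xi yi.
have b0 : (0 < b)%E by rewrite (lt_trans _ tb).
pose D (s : R) := (x s - y s) ^+ 2.
have dD (s : R) : 0 < s -> s <= t ->
    is_derive s 1 D (2 * ((x s - y s) * (f (x s) - f (y s)))).
  move=> s0 st; have sb : (s%:E < b)%E by rewrite (le_lt_trans _ tb)// lee_fin.
  have dx := solution_is_derive sx s0 sb.
  have dy := solution_is_derive sy s0 sb.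
  have -> : D = (x \- y) * (x \- y) by apply/funext => z; rewrite /D expr2.
  by apply: is_derive_eq; rewrite /GRing.scale/=; ring.
have cD : {within `[0, t], continuous D}.
  apply/(continuous_within_itvP _ t0); split.
  - move=> s; rewrite in_itv/= => /andP[s0 st].
    exact: is_derive_continuous (dD _ s0 (ltW st)).
  - have F0 : Filter (0 : R)^'+ by exact: at_right_proper_filter.
    have cxy := @cvgB _ _ _ _ F0 _ _ _ _ (solution_cvg0 sx b0) (solution_cvg0 sy b0).
    exact: (@cvgM _ _ _ F0 _ _ _ _ cxy cxy).
  - exact/cvg_at_left_filter/is_derive_continuous/(dD _ t0 (lexx _)).
have dD' (s : R) : s \in `]0, t[ ->
    is_derive s 1 D (2 * ((x s - y s) * (f (x s) - f (y s)))).
  by rewrite in_itv/= => /andP[s0 /ltW]; exact: dD.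
have [s /[!in_itv]/= /andP[s0 st] E] := MVT t0 dD' cD.
have : D t <= 0.
  have -> : D t = D t - D 0 by rewrite /D xi yi subrr expr0n subr0.
  rewrite E pmulr_lle0 ?subr_gt0// pmulr_rle0//.
  have [xy|/ltW xy] := leP (x s) (y s).
    by rewrite mulr_le0_ge0 ?subr_le0 ?subr_ge0 ?fdecr.
  by rewrite mulr_ge0_le0 ?subr_le0 ?subr_ge0 ?fdecr.
by rewrite /D le_eqVlt ltNge sqr_ge0 orbF sqrf_eq0 subr_eq0 => /eqP.
Qed.

(** * Scalar systems with a known time to the origin

In this section [tau r] is the time that [x' = - g x] takes from [r] to [0],
described by its derivative and its limits at [0] and at infinity. For such a
finite [tau] to exist, [g] cannot be Lipschitz at [0], so uniqueness of solutions
rests on the monotonicity of [g]. *)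

Section scalar_system.
Context {R : realType}.
Variables (g tau : R -> R) (T : R).
Hypothesis g0 : g 0 = 0.
Hypothesis g_gt0 : forall r : R, 0 < r -> 0 < g r.
Hypothesis g_homo : forall r s : R, 0 <= r -> r <= s -> g r <= g s.
Hypothesis g_continuous : forall r : R, 0 < r -> {for r, continuous g}.
Hypothesis g_cvg0 : g r @[r --> 0^'+] --> 0.
Hypothesis tau0 : tau 0 = 0.
Hypothesis tau_cvg0 : tau r @[r --> 0^'+] --> 0.
Hypothesis dtau : forall r : R, 0 < r -> is_derive r 1 tau (g r)^-1.
Hypothesis tau_cvgy : tau r @[r --> +oo] --> T.

Definition feedback (x : R) : R := - (g `|x| * Num.sg x).

Lemma feedback_gt0 x : 0 < x -> feedback x = - g x.
Proof. by move=> x0; rewrite /feedback gtr0_norm// gtr0_sg// mulr1. Qed.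

Lemma feedbackN x : feedback (- x) = - feedback x.
Proof. by rewrite /feedback normrN sgrN mulrN. Qed.

Lemma feedback_at0 : feedback 0 = 0.
Proof. by rewrite /feedback sgr0 mulr0 oppr0. Qed.

Lemma feedback_le0 x : 0 <= x -> feedback x <= 0.
Proof.
rewrite le_eqVlt => /predU1P[<-|x0]; first by rewrite feedback_at0.
by rewrite feedback_gt0// oppr_le0 ltW// g_gt0.
Qed.

Lemma feedback_homo : {homo feedback : u v /~ u <= v}.
Proof.
have pos u v : 0 <= u -> u <= v -> feedback v <= feedback u.
  rewrite le_eqVlt => /predU1P[<- v0|u0 uv].
    by rewrite feedback_at0; exact: feedback_le0.
  by rewrite !feedback_gt0 ?(lt_le_trans u0)// lerN2 g_homo// ltW.
move=> v u uv; have [u0|u0] := leP 0 u; first exact: pos.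
have [v0|v0] := leP 0 v.
  rewrite (le_trans (feedback_le0 v0))// -oppr_le0 -feedbackN feedback_le0//.
  by rewrite oppr_ge0 ltW.
by rewrite -lerN2 -!feedbackN pos ?lerN2// oppr_ge0 ltW.
Qed.

Lemma feedback_continuous : continuous feedback.
Proof.
have pos x : 0 < x -> {for x, continuous feedback}.
  move=> x0; rewrite /prop_for /continuous_at feedback_gt0//.
  apply: cvg_trans (cvgN (g_continuous x0)); apply: near_eq_cvg.
  near=> y; rewrite feedback_gt0//.
  by near: y; exact: lt_nbhsr.
move=> x; have [x0|x0|->] := ltgtP x 0; last 2 first.
- exact: pos.
- rewrite /continuous_at feedback_at0; apply/cvgrPdist_le => e e0.
  move/cvgrPdist_le : g_cvg0 => /(_ _ e0)[d /= d0 gd].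
  exists d => //= y; rewrite /ball_/= sub0r normrN => yd.
  rewrite sub0r normrN /feedback normrN normrM.
  have [->|y0] := eqVneq y 0; first by rewrite normr0 g0 normr0 mul0r ltW.
  rewrite normr_sg y0 mulr1.
  have := gd `|y|; rewrite /ball_/= !sub0r !normrN normr_id; apply => //.
  by rewrite normr_gt0.
have -> : feedback = -%R \o feedback \o -%R.
  by apply/funext => y /=; rewrite feedbackN opprK.
have cN (y : R) : {for y, continuous (-%R : R -> R)} by exact: opp_continuous.
have nx : 0 < - x by rewrite oppr_gt0.
exact: continuous_comp (continuous_comp (cN x) (pos _ nx)) (cN _).
Unshelve. all: by end_near. Qed.

Lemma tau_continuous (r : R) : 0 < r -> {within `[0, r], continuous tau}.
Proof.
move=> r0; apply/(continuous_within_itvP _ r0); split.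
- move=> s; rewrite in_itv/= => /andP[s0 _].
  exact: is_derive_continuous (dtau s0).
- by rewrite tau0.
- exact/cvg_at_left_filter/is_derive_continuous/(dtau r0).
Qed.

Lemma tau_lt r s : 0 <= r -> r < s -> tau r < tau s.
Proof.
move=> r0 rs; have s0 := le_lt_trans r0 rs.
have dt (t : R) : t \in `]r, s[ -> is_derive t 1 tau (g t)^-1.
  by rewrite in_itv/= => /andP[rt _]; apply: dtau; exact: le_lt_trans rt.
have ct : {within `[r, s], continuous tau}.
  apply: continuous_subspaceW (tau_continuous s0).
  by move=> t; rewrite /= !in_itv/= => /andP[rt ->]; rewrite (le_trans r0).
have [t] := MVT rs dt ct; rewrite in_itv/= => /andP[rt _] E.
by rewrite -subr_gt0 E mulr_gt0 ?subr_gt0// invr_gt0 g_gt0// (le_lt_trans r0).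
Qed.

Lemma tau_le r s : 0 <= r -> r <= s -> tau r <= tau s.
Proof.
by move=> r0; rewrite le_eqVlt => /predU1P[->//|rs]; rewrite ltW// tau_lt.
Qed.

Lemma tau_le_inv r s : 0 <= s -> tau r <= tau s -> r <= s.
Proof. by move=> s0; apply: contraTT; rewrite -!ltNge => /tau_lt; exact. Qed.

Lemma tau_gt0 r : 0 < r -> 0 < tau r.
Proof. by move=> r0; rewrite -tau0 tau_lt. Qed.

Lemma tau_ltT r : 0 <= r -> tau r < T.
Proof.
move=> r0; have r1 : r < r + 1 by rewrite ltrDl.
apply: (lt_le_trans (tau_lt r0 r1)).
apply: cvgr_to_ge tau_cvgy _.
near=> s; apply: tau_le; first by rewrite addr_ge0.
by near: s; apply: nbhs_pinfty_ge; exact: num_real.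
Unshelve. all: by end_near. Qed.

Lemma T_gt0 : 0 < T. Proof. by rewrite -tau0 tau_ltT. Qed.

Lemma tau_gt_lim s : s < T -> exists2 M, 0 < M & s < tau M.
Proof.
move=> sT; near (+oo : set_system R) => M; exists M.
  by near: M; exact: nbhs_pinfty_gt.
near: M; exact: (cvgr_gt _ tau_cvgy).
Unshelve. all: by end_near. Qed.

Lemma tau_surj s : 0 < s -> s < T -> exists2 r, 0 < r & tau r = s.
Proof.
move=> s0 /tau_gt_lim[M M0 sM].
have [|r] := @IVT _ tau 0 M s (ltW M0) (tau_continuous M0).
  by rewrite tau0 min_l ?max_r ?(ltW (tau_gt0 M0))// !ltW.
rewrite in_itv/= => /andP[r0 _] rs; exists r => //.
rewrite lt_neqAle r0 andbT; apply/eqP => r0'.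
by move: rs s0; rewrite -r0' tau0 => <-; rewrite ltxx.
Qed.

(** The state from which the origin is exactly [s] away in time. The default [0]
of [xget] is the intended value for [s <= 0]: a solution stays at the origin
once it has reached it. *)
Definition state_at (s : R) : R := xget 0 [set r | 0 < r /\ tau r = s].
Local Notation X := state_at.

Lemma state_at_le0 s : s <= 0 -> X s = 0.
Proof.
move=> s0; rewrite /state_at; case: xgetP => // r _ [r0 rs].
by move: (tau_gt0 r0); rewrite rs ltNge s0.
Qed.

Lemma state_at_ge0 s : 0 <= X s.
Proof. by rewrite /state_at; case: xgetP => // r _ [/ltW]. Qed.

Lemma state_at_spec s : 0 < s -> s < T -> 0 < X s /\ tau (X s) = s.
Proof.
move=> s0 sT; rewrite /state_at; case: xgetP => [r _ []//|].
by have [r r0 rs] := tau_surj s0 sT => /(_ r)[].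
Qed.

Lemma tauK r : 0 <= r -> X (tau r) = r.
Proof.
rewrite le_eqVlt => /predU1P[<-|r0]; first by rewrite tau0 state_at_le0.
have [X0 tX] := state_at_spec (tau_gt0 r0) (tau_ltT (ltW r0)).
by apply/eqP; rewrite eq_le; apply/andP; split; apply: tau_le_inv;
  rewrite ?tX// ltW.
Qed.

Lemma state_at_le r s : 0 <= r -> s <= tau r -> X s <= r.
Proof.
move=> r0 sr; have [s0|s0] := leP s 0; first by rewrite state_at_le0.
have [_ tX] := state_at_spec s0 (le_lt_trans sr (tau_ltT r0)).
by apply: tau_le_inv => //; rewrite tX.
Qed.

(** For [s > 0] this is the derivative of an inverse function, and for [s < 0] the
function is locally constant. At [s = 0] the right difference quotient tends to
[0] because the mean value theorem for [tau] gives [X h = g t * h] for some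
[t < X h], and [g] tends to [0] at [0]. *)
Lemma is_derive_state_at (s : R) : s < T -> is_derive s 1 X (g (X s)).
Proof.
move=> sT; have [s0|s0|s0] := ltgtP s 0.
- rewrite state_at_le0 ?(ltW s0)// g0.
  apply/is_derive_cvg; have c0 : (0 : R) @[h --> (0 : R)^'] --> (0 : R) by exact: cvg_cst.
  apply: cvg_trans c0.
  apply: near_eq_cvg; near=> h; rewrite [X s]state_at_le0 ?(ltW s0)// state_at_le0 ?subrr ?scaler0//.
  rewrite -lerBrDr sub0r (le_trans (ler_norm _))//.
  by near: h; apply: dnbhs0_le; rewrite oppr_gt0.
- have [X0 tX] := state_at_spec s0 sT.
  rewrite -{1}tX -[g _]invrK.
  apply: is_derive_inverse (dtau X0) _; last 1 first.
  + by rewrite invr_eq0 gt_eqF// g_gt0.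
  + near=> r; apply: tauK; apply: ltW; near: r; exact: lt_nbhsr.
  + near=> r; apply: is_derive_continuous (dtau _); near: r; exact: lt_nbhsr.
- rewrite s0 state_at_le0// g0; apply/is_derive_cvg.
  apply/cvgrPdist_le => e e0.
  (* States below [d] have rate at most [e], and times below [tau d] lead to
     states below [d]. *)
  have [d d0 gd] : exists2 d, 0 < d & g d <= e.
    near (0 : R)^'+ => d; exists d; first by near: d; exact: nbhs_right_gt.
    by near: d; exact: cvgr_le _ g_cvg0 _ e0.
  near=> h; rewrite addr0 (state_at_le0 (lexx 0)) subr0 sub0r normrN.
  have [h0|h0] := leP h 0; first by rewrite state_at_le0// scaler0 normr0 ltW.
  have hd : h < tau d.
    rewrite (le_lt_trans (ler_norm _))//.
    by near: h; apply: dnbhs0_lt; exact: tau_gt0.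
  have [X0 tX] := state_at_spec h0 (lt_trans hd (tau_ltT (ltW d0))).
  have dX (t : R) : t \in `]0, X h[ -> is_derive t 1 tau (g t)^-1.
    by rewrite in_itv/= => /andP[t0 _]; exact: dtau.
  have [t] := MVT X0 dX (tau_continuous X0).
  rewrite in_itv/= tX tau0 !subr0 => /andP[t0 tX'] hE.
  rewrite /GRing.scale/= ger0_norm ?mulr_ge0 ?invr_ge0 ?(ltW h0) ?(ltW X0)//.
  rewrite mulrC ler_pdivrMr// {1}(_ : X h = g t * h); last first.
    by rewrite [in RHS]hE mulrA mulfV ?mul1r// gt_eqF// g_gt0.
  rewrite ler_wpM2r ?(ltW h0)// (le_trans _ gd)// g_homo ?(ltW t0)//.
  by rewrite (le_trans (ltW tX'))// state_at_le// ltW.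
Unshelve. all: by end_near. Qed.

(** The solution from [x0], obtained by running [X] backwards from [tau |x0|]. *)
Definition trajectory (x0 t : R) : R := Num.sg x0 * X (tau `|x0| - t).

Lemma trajectory_solution (x0 : R) :
  is_solution (feedback : R^o -> R^o) x0 +oo%E (trajectory x0 : R -> R^o).
Proof.
split; first by rewrite /trajectory subr0 tauK// -numEsg.
move=> t t0 _.
have sT : tau `|x0| - t < T by rewrite (le_lt_trans _ (tau_ltT (normr_ge0 x0)))// gerBl.
have dX := is_derive_state_at sT.
have dL : is_derive t 1 (fun t => tau `|x0| - t) (- 1).
  by apply: is_derive_eq; rewrite add0r mulrN1.
have dZ : is_derive t 1 (trajectory x0) (feedback (trajectory x0 t)).
  have dC := @is_derive1_comp _ X (fun t => tau `|x0| - t) _ _ _ dX dL.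
  have -> : trajectory x0 = Num.sg x0 *: (X \o (fun t => tau `|x0| - t)) by [].
  apply: is_derive_eq; rewrite /GRing.scale/=.
  rewrite /feedback /trajectory normrM normr_sg sgrM sgr_id.
  rewrite (ger0_norm (state_at_ge0 _)).
  have [->|x00] := eqVneq x0 0; first by rewrite sgr0 !mul0r mulr0 oppr0.
  rewrite mul1r; have := state_at_ge0 (tau `|x0| - t).
  rewrite le_eqVlt => /predU1P[<-|X0]; first by rewrite g0 !mul0r mulr0 oppr0.
  by rewrite (gtr0_sg X0) mulr1 mulrN1 mulrN mulrC.
move/is_derive_cvg : dZ => dZ.
apply: cvg_trans dZ; apply: cvg_app.
exact: cvg_within.
Qed.

(** Uniqueness turns every statement about all solutions from [x0] into one about
[trajectory x0]: Lyapunov stability holds with [delta = eps], the settling time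
is [tau |x0|], and its supremum is the limit [T] of [tau]. *)
Theorem feedback_strong_predefined_time :
  strong_predefined_time (feedback : R^o -> R^o) T.
Proof.
have uniq (x0 : R^o) b (x : R -> R^o) : is_solution feedback x0 b x ->
    forall t, 0 <= t -> (t%:E < b)%E -> trajectory x0 t = x t.
  move=> sx; apply: solution_unique feedback_homo _ sx.
  have [tr0 trs] := trajectory_solution x0; split => // t t0 tb.
  by apply: trs => //; exact: ltry.
have glob (x0 : R^o) : solutions_global feedback x0.
  split; first by exists (trajectory x0); exact: trajectory_solution.
  move=> b x b0 sx; exists (trajectory x0); first exact: trajectory_solution.
  exact: uniq sx.
have settled (x0 : R^o) : settled_after feedback x0 (tau `|x0|).
  split; first by rewrite -tau0 tau_le.
  move=> x sx t tt; rewrite -(uniq _ _ _ sx) ?ltry//; last first.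
    by rewrite (le_trans _ tt)// -tau0 tau_le.
  by rewrite /trajectory state_at_le0 ?subr_le0// mulr0.
have settling (x0 : R^o) : settling_time feedback x0 = (tau `|x0|)%:E.
  apply/eqP; rewrite eq_le; apply/andP; split.
    by apply: ereal_inf_lbound; exists (tau `|x0|).
  apply: le_ereal_inf_tmp => _ [t [t0 st] <-]; rewrite lee_fin leNgt; apply/negP => tt.
  have := st _ (trajectory_solution x0) t (lexx _).
  have s0 : 0 < tau `|x0| - t by rewrite subr_gt0.
  have sT : tau `|x0| - t < T by rewrite (le_lt_trans _ (tau_ltT (normr_ge0 x0)))// gerBl.
  have [X0 _] := state_at_spec s0 sT.
  move=> /eqP; rewrite mulf_eq0 (gt_eqF X0) orbF sgr_eq0 => /eqP x00.
  by move: tt; rewrite x00 normr0 tau0 ltNge t0.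
have lyap : lyapunov_stable (feedback : R^o -> R^o).
  split; [exact: feedback_continuous|exact: feedback_at0|].
  move=> e e0; exists e => // x0 x0e; split; first exact: glob.
  move=> x sx t t0; rewrite -(uniq _ _ _ sx) ?ltry//.
  apply: le_lt_trans x0e; rewrite /trajectory normrM.
  rewrite (ger0_norm (state_at_ge0 _)).
  rewrite -[leRHS]mul1r ler_pM ?state_at_ge0 ?normr_sg ?lern1 ?leq_b1//.
  by apply: state_at_le => //; rewrite gerBl.
have gfts : globally_finite_time_stable (feedback : R^o -> R^o).
  by split => // x0; split; [exact: glob|exists (tau `|x0|)].
have leT (x0 : R^o) : (settling_time feedback x0 <= T%:E)%E.
  by rewrite settling lee_fin ltW// tau_ltT.
split.
  split => //; first exact: T_gt0.
  by split => //; exists T => //; exact: T_gt0.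
apply/eqP; rewrite eq_le; apply/andP; split.
  by apply: ge_ereal_sup => _ [x0 _ <-].
apply/lee_subgt0Pr => e e0; rewrite -EFinB.
have [M M0 /ltW TM] : exists2 M, 0 < M & T - e < tau M.
  by apply: tau_gt_lim; rewrite ltrBlDr ltrDl.
apply: (@le_trans _ _ (tau M)%:E); first by rewrite lee_fin.
by apply: ereal_sup_ubound; exists M => //; rewrite settling gtr0_norm.
Qed.

End scalar_system.

(** * The rate (alpha r^p + beta r^q)^k *)

Lemma cvg_to_at_right0 (R : realType) (F : set_system R) (FF : Filter F)
    (u : R -> R) :
  u r @[r --> F] --> 0 -> (\forall r \near F, 0 < u r) ->
  u r @[r --> F] --> 0^'+.
Proof.
move=> cu u0 A.
change ((\forall v \near 0, 0 < v -> A v) -> \forall r \near F, A (u r)).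
by move/cu; apply: filterS2 u0 => r ur; exact.
Qed.

Lemma cvg_mull0 (R : realType) (F : set_system R) (FF : Filter F)
    (c : R) (u : R -> R) :
  u r @[r --> F] --> 0 -> c * u r @[r --> F] --> 0.
Proof.
move=> cu; suff: c * u r @[r --> F] --> c * 0 by rewrite mulr0.
by apply: cvgM => //; exact: cvg_cst.
Qed.

Lemma powR_cvgy (R : realType) (s : R) : 0 < s ->
  r `^ s @[r --> +oo] --> +oo.
Proof.
move=> s0; apply/cvgryPge => A; near=> r.
have A0 : 0 <= `|A| `^ s^-1 by exact: powR_ge0.
have Ar : `|A| `^ s^-1 <= r by near: r; apply: nbhs_pinfty_ge; exact: num_real.
rewrite (le_trans (ler_norm _))//.
have -> : `|A| = (`|A| `^ s^-1) `^ s.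
  by rewrite -powRrM mulVf ?gt_eqF// powRr1.
by apply: ge0_ler_powR; rewrite ?nnegrE ?(ltW s0)// (le_trans A0).
Unshelve. all: by end_near. Qed.

Section rational_power_feedback.
Context {R : realType}.
Variables (alpha beta p q k : R).
Hypotheses (alpha_gt0 : 0 < alpha) (beta_gt0 : 0 < beta).
Hypotheses (p_gt0 : 0 < p) (q_gt0 : 0 < q) (k_gt0 : 0 < k).
Hypotheses (kp_lt1 : k * p < 1) (kq_gt1 : 1 < k * q).

Definition power_rate (c r : R) : R := c * (alpha * r `^ p + beta * r `^ q) `^ k.

Let base_gt0 (r : R) : 0 < r -> 0 < alpha * r `^ p + beta * r `^ q.
Proof. by move=> r0; rewrite addr_gt0// mulr_gt0// powR_gt0. Qed.

Lemma power_rate0 c : power_rate c 0 = 0.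
Proof. by rewrite /power_rate !powR0 ?gt_eqF// !mulr0 addr0 powR0 ?mulr0// gt_eqF. Qed.

Lemma power_rate_gt0 c r : 0 < c -> 0 < r -> 0 < power_rate c r.
Proof. by move=> c0 r0; rewrite mulr_gt0// powR_gt0// base_gt0. Qed.

Lemma power_rate_homo c (r s : R) : 0 < c -> 0 <= r -> r <= s -> power_rate c r <= power_rate c s.
Proof.
move=> c0 r0 rs; have s0 := le_trans r0 rs.
rewrite ler_pM2l//; apply: ge0_ler_powR; first exact: ltW.
- by rewrite nnegrE addr_ge0// mulr_ge0 ?powR_ge0 ?ltW.
- by rewrite nnegrE addr_ge0// mulr_ge0 ?powR_ge0 ?ltW.
by apply: lerD; rewrite ler_pM2l//; apply: ge0_ler_powR; rewrite ?nnegrE// ltW.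
Qed.

Lemma power_rate_continuous c (r : R) : 0 < r -> {for r, continuous (power_rate c)}.
Proof.
move=> r0; apply: cvgM; first exact: cvg_cst.
have cb : {for r, continuous (fun x : R => alpha * x `^ p + beta * x `^ q)}.
  by apply: cvgD; (apply: cvgM; [exact: cvg_cst|exact: powR_continuous]).
exact: continuous_comp cb (powR_continuous (s := k) (base_gt0 r0)).
Qed.

Lemma power_rate_cvg0 c : power_rate c r @[r --> 0^'+] --> 0.
Proof.
have F0 : Filter (0 : R)^'+ by exact: at_right_proper_filter.
have cb : alpha * r `^ p + beta * r `^ q @[r --> 0^'+] --> 0.
  suff: alpha * r `^ p + beta * r `^ q @[r --> 0^'+] --> 0 + 0 by rewrite addr0.
  by apply: cvgD; apply: cvg_mull0; exact: powR_cvg0.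
have b0 : \forall r \near 0^'+, 0 < alpha * r `^ p + beta * r `^ q.
  by near=> r; apply: base_gt0.
apply: cvg_mull0.
exact: cvg_comp (cvg_to_at_right0 F0 cb b0) (powR_cvg0 k_gt0).
Unshelve. all: by end_near. Qed.

Let mp := (1 - k * p) / (q - p).
Let mq := (k * q - 1) / (q - p).

Let qp_gt0 : 0 < q - p.
Proof. by rewrite subr_gt0 -(ltr_pM2l k_gt0) (lt_trans kp_lt1). Qed.

Let mp_gt0 : 0 < mp. Proof. by rewrite divr_gt0// subr_gt0. Qed.
Let mq_gt0 : 0 < mq. Proof. by rewrite divr_gt0// subr_gt0. Qed.
Let mpq : mp + mq = k.
Proof. by rewrite /mp /mq; field; rewrite gt_eqF. Qed.

(** The variable in which the integral of the reciprocal rate becomes a Beta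
integral. *)
Let w (r : R) : R := beta / alpha * r `^ (q - p).

Let w_gt0 (r : R) : 0 < r -> 0 < w r.
Proof. by move=> r0; rewrite !mulr_gt0 ?invr_gt0 ?powR_gt0. Qed.

(** The integral of [(alpha x^p + beta x^q)^(-k)] over the half-line, which is the
time needed to come from infinity when the rate is [power_rate 1]. *)
Definition normalization : R :=
  Gamma mp * Gamma mq / (alpha `^ k * Gamma k * (q - p)) * (alpha / beta) `^ mp.

Lemma normalization_gt0 : 0 < normalization.
Proof.
by rewrite mulr_gt0 ?powR_gt0 ?divr_gt0// !mulr_gt0 ?Gamma_gt0 ?powR_gt0.
Qed.

Definition time_to_origin (Tc r : R) : R :=
  Tc * Gamma k / (Gamma mp * Gamma mq) * incomplete_beta mp mq (w r).

Lemma time_to_origin0 Tc : time_to_origin Tc 0 = 0.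
Proof.
by rewrite /time_to_origin /w powR0 ?gt_eqF// mulr0 incomplete_beta0// mulr0.
Qed.

Lemma time_to_origin_cvg0 Tc : time_to_origin Tc r @[r --> 0^'+] --> 0.
Proof.
have F0 : Filter (0 : R)^'+ by exact: at_right_proper_filter.
have cw : w r @[r --> 0^'+] --> 0.
  by apply: cvg_mull0; exact: powR_cvg0.
have w0 : \forall r \near 0^'+, 0 < w r by near=> r; apply: w_gt0.
apply: cvg_mull0.
exact: cvg_comp (cvg_to_at_right0 F0 cw w0) (cvg_incomplete_beta0 mp_gt0 mq_gt0).
Unshelve. all: by end_near. Qed.

Lemma time_to_origin_cvgy Tc : time_to_origin Tc r @[r --> +oo] --> Tc.
Proof.
have cw : w r @[r --> +oo] --> +oo.
  apply: gt0_cvgMry; first by rewrite divr_gt0.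
  exact: powR_cvgy.
pose K := Tc * Gamma k / (Gamma mp * Gamma mq).
have E : K * (Gamma mp * Gamma mq / Gamma (mp + mq)) = Tc.
  by rewrite mpq /K; field; rewrite !gt_eqF// Gamma_gt0.
suff: time_to_origin Tc r @[r --> +oo] --> K * (Gamma mp * Gamma mq / Gamma (mp + mq)).
  by rewrite E.
apply: cvgM; first exact: cvg_cst.
exact: cvg_comp cw (cvg_incomplete_beta mp_gt0 mq_gt0).
Qed.

(** The chain rule for [w], after the factorization
[alpha r^p + beta r^q = alpha r^p (1 + w r)]. The powers of [r] cancel because
[(q - p) (mp - 1) + (q - p - 1) = - k p]. *)
Lemma is_derive_time_to_origin Tc (r : R) : 0 < Tc -> 0 < r ->
  is_derive r 1 (time_to_origin Tc) (power_rate (normalization / Tc) r)^-1.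
Proof.
move=> Tc0 r0.
have dw : is_derive r 1 w (beta / alpha * ((q - p) * r `^ (q - p - 1))).
  exact: is_deriveZ (is_derive1_powR (q - p) r0).
have dB := is_derive_incomplete_beta mp_gt0 mq_gt0 (w_gt0 r0).
have dC := is_derive1_comp dB dw.
have -> : time_to_origin Tc = (Tc * Gamma k / (Gamma mp * Gamma mq)) *:
  (incomplete_beta mp mq \o w) by [].
apply: is_derive_eq; rewrite [LHS]/GRing.scale/= /beta_integrand mpq.
have w1 : 0 < 1 + w r by rewrite addr_gt0// w_gt0.
have Ebase : alpha * r `^ p + beta * r `^ q = alpha * r `^ p * (1 + w r).
  have -> : r `^ q = r `^ p * r `^ (q - p).
    rewrite -powRD ?(gt_eqF r0) ?implybT//; congr (_ `^ _); ring.
  by rewrite /w; field; rewrite gt_eqF.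
have Ek : (alpha * r `^ p * (1 + w r)) `^ k =
    alpha `^ k * (r `^ p) `^ k * (1 + w r) `^ k.
  by rewrite !powRM ?mulr_ge0 ?powR_ge0 ?(ltW alpha_gt0) ?(ltW w1).
rewrite /power_rate Ebase Ek.
have Er : w r `^ (mp - 1) * r `^ (q - p - 1) =
    (beta / alpha) `^ (mp - 1) * (r `^ p) `^ (- k).
  rewrite /w powRM ?powR_ge0 ?divr_ge0 ?ltW// -!powRrM -mulrA.
  rewrite -powRD ?(gt_eqF r0) ?implybT//; congr (_ * _ `^ _).
  by rewrite /mp; field; rewrite gt_eqF.
have Eab : (alpha / beta) `^ mp * ((beta / alpha) * (beta / alpha) `^ (mp - 1)) = 1.
  rewrite mulr_powRB1 ?divr_ge0 ?ltW// -powRM ?divr_ge0 ?ltW//.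
  rewrite (_ : _ * _ = 1) ?powR1//.
  by field; rewrite !gt_eqF.
have b0 : 0 < (beta / alpha) `^ (mp - 1) by rewrite powR_gt0// divr_gt0.
have e0 : beta / alpha * (beta / alpha) `^ (mp - 1) != 0.
  by rewrite gt_eqF// !mulr_gt0 ?invr_gt0.
have cE : (alpha / beta) `^ mp = (beta / alpha * (beta / alpha) `^ (mp - 1))^-1.
  by rewrite -[LHS](mulfK e0) Eab mul1r.
have E (K u v W x y : R) : K * (u * W * (x * (y * v))) = K * W * x * y * (u * v) by ring.
rewrite E Er /normalization cE !powRN.
have Gp := Gamma_gt0 mp_gt0; have Gq := Gamma_gt0 mq_gt0.
have Gk := Gamma_gt0 k_gt0.
have P0 : 0 < (r `^ p) `^ k by rewrite !powR_gt0.
have W0 : 0 < (1 + w r) `^ k by rewrite powR_gt0.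
have A0 : 0 < alpha `^ k by rewrite powR_gt0.
by field; rewrite !gt_eqF.
Qed.

End rational_power_feedback.

(** * The strong predefined time *)

Unset Implicit Arguments.

Theorem mainTheorem3 (R : realType) (alpha beta p q k Tc : R)
    (alpha_gt0 : 0 < alpha) (beta_gt0 : 0 < beta)
    (p_gt0 : 0 < p) (q_gt0 : 0 < q) (k_gt0 : 0 < k)
    (kp_lt1 : k * p < 1) (kq_gt1 : 1 < k * q) (Tc_gt0 : 0 < Tc) :
  let mp := (1 - k * p) / (q - p) in
  let mq := (k * q - 1) / (q - p) in
  let gamma := Gamma mp * Gamma mq / (alpha `^ k * Gamma k * (q - p))
               * (alpha / beta) `^ mp in
  let f : R^o -> R^o := fun x : R =>
    - (gamma / Tc) * (alpha * `|x| `^ p + beta * `|x| `^ q) `^ k * Num.sg x in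
  strong_predefined_time f Tc.
Proof.
move=> mp mq gamma f.
(* [gamma] unfolds to [normalization] for the given parameters. *)
have gamma0 : 0 < gamma by exact: normalization_gt0.
have c0 : 0 < gamma / Tc by rewrite divr_gt0.
have -> : f = feedback (power_rate alpha beta p q k (gamma / Tc)).
  by apply/funext => x; rewrite /f /feedback /power_rate; ring.
apply: (@feedback_strong_predefined_time _ _ (time_to_origin alpha beta p q k Tc)).
- exact: power_rate0.
- by move=> r r0; exact: power_rate_gt0.
- by move=> r s r0 rs; exact: power_rate_homo.
- by move=> r r0; exact: power_rate_continuous.
- exact: power_rate_cvg0.
- exact: time_to_origin0.
- exact: time_to_origin_cvg0.
- by move=> r r0; exact: is_derive_time_to_origin.
- exact: time_to_origin_cvgy.
Qed.
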